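(* Let $R$ be a centrally symmetric hexagon in the triangular lattice whose sides (in three directions) have lengths $a$, $b$, $c$ (positive integers). Then the forcing number of $R$ with respect to lozenge tilings is $\min(a,b,c)$.
   Context: The triangular lattice tiles the plane by unit equilateral triangles. A centrally symmetric hexagon with sides $a,b,c$ is the region bounded by a lattice hexagon whose sides, in counterclockwise order, have lengths $a,b,c,a,b,c$ and are parallel to the lattice directions. A lozenge is the union of two triangles sharing an edge; a lozenge tiling of $R$ is a tiling of $R$ by lozenges. A forcing set of a tiling $T$ is a subset of the lozenges of $T$ contained in no other lozenge tiling of $R$; $f(T,R)$ is the minimum size of a forcing set of $T$, and the forcing number of $R$ is $\min_T f(T,R)$ over all lozenge tilings $T$ of $R$. *)

(* Defs.v *)
From mathcomp Require Export all_boot all_order all_algebra finmap.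

Set Implicit Arguments.
Unset Strict Implicit.
Unset Printing Implicit Defensive.

Import GRing.Theory.

(* The point (x, y) is x e1 + y e2, with e1 = (1, 0) and e2 = (1/2, sqrt 3/2). *)
Definition point : Type := (int * int)%type.

Definition e1 : point := (1%R, 0%R).
Definition e2 : point := (0%R, 1%R).

(* The counterclockwise rotation by 60 degrees about the origin:
   e1 |-> e2 and e2 |-> e2 - e1. *)
Definition rot60 (v : point) : point := ((- v.2)%R, (v.1 + v.2)%R).

(* The six lattice directions, in counterclockwise order; dir is 6-periodic. *)
Definition dir (k : nat) : point := iter k rot60 e1.

(* A positive multiple of the Euclidean determinant, since (e1, e2) is
   positively oriented. *)
Definition det2 (u v : point) : int := (u.1 * v.2 - u.2 * v.1)%R.

(* (v, true) is the triangle v, v + e1, v + e2 (pointing up), and (v, false)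
   is its mirror image in the edge {v + e1, v + e2} (pointing down). *)
Definition triangle : Type := (point * bool)%type.

Definition vertices (t : triangle) : {fset point} :=
  [fset (if t.2 then t.1 else t.1 + e1 + e2)%R;
        (t.1 + e1)%R; (t.1 + e2)%R]%fset.

Definition share_edge (s t : triangle) : Prop :=
  #|` (vertices s `&` vertices t)%fset| = 2.

Definition region : Type := {fset triangle}.

Definition side_length (a b c k : nat) : nat := nth 0 [:: a; b; c; a; b; c] k.

(* The hexagon with first corner p and first side in direction dir d; its
   k-th side goes from corner k to corner k.+1. *)
Definition corner (a b c : nat) (p : point) (d k : nat) : point :=
  (p + \sum_(j < k) dir (d + j) *+ side_length a b c j)%R.

(* The boundary is traversed counterclockwise and the hexagon is convex, so
   it is the set of points lying weakly to the left of all its sides. *)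
Definition in_hexagon (a b c : nat) (p : point) (d : nat) (v : point) : Prop :=
  forall k : nat, k < 6 ->
    (0 <= det2 (dir (d + k)) (v - corner a b c p d k))%R.

Definition is_hexagon (a b c : nat) (R : region) : Prop :=
  exists (p : point) (d : nat), forall t : triangle,
    t \in R <-> (forall v, v \in vertices t -> in_hexagon a b c p d v).

Definition lozenge (L : {fset triangle}) : Prop :=
  exists s t : triangle, share_edge s t /\ L = [fset s; t]%fset.

Definition lozenge_tiling (R : region) (T : {fset {fset triangle}}) : Prop :=
  [/\ forall L, L \in T -> lozenge L,
      forall L, L \in T -> (L `<=` R)%fset
    & forall t, t \in R -> exists! L, L \in T /\ t \in L].

Definition forcing_set (R : region) (T F : {fset {fset triangle}}) : Prop :=
  (F `<=` T)%fset /\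
  forall T', lozenge_tiling R T' -> (F `<=` T')%fset -> T' = T.

Definition is_minimum (P : nat -> Prop) (n : nat) : Prop :=
  P n /\ forall m, P m -> n <= m.

(* min_forcing R T n means f(T, R) = n. *)
Definition min_forcing (R : region) (T : {fset {fset triangle}}) : nat -> Prop :=
  is_minimum (fun k => exists F, forcing_set R T F /\ #|` F|%fset = k).

Definition forcing_number (R : region) : nat -> Prop :=
  is_minimum (fun k => exists T, lozenge_tiling R T /\ min_forcing R T k).

(* Main.v *)
Require Import Defs.
From mathcomp Require Import all_boot all_order all_algebra finmap.
From mathcomp Require Import all_field zify.

Set Implicit Arguments.
Unset Strict Implicit.
Unset Printing Implicit Defensive.

Import Order.TTheory GRing.Theory Num.Theory.

(* Tilings are perfect matchings between up and down triangles.

   Lower bound.  Say a <= b, c.  Weight the adjacencies so that a function on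
   the up triangles is harmonic when f(x, y + 1) = f(x, y) - z^y f(x + 1, y),
   where z is a primitive (b + c)-th root of unity.  The rows of f then have
   generating polynomials P * prod_(i < y) (X - z^i); as the full product is
   X^(b + c) - 1, every P of degree < a gives a solution on the whole hexagon.
   So the weighted adjacency matrix has an a-dimensional kernel, and fewer
   than a lozenges can be avoided by a nonzero kernel element.  No down
   triangle sees exactly one up triangle of its support, so one can walk in the
   support, alternating between lozenges of the tiling and other adjacencies;
   the walk closes up to an alternating cycle that avoids the chosen lozenges.

   Upper bound.  Take the tiling by three rhombi a x b, b x c, c x a meeting in
   one point (the empty plane partition) and the a lozenges on the short
   diagonal of the a x b rhombus issued from that point.  Every alternating
   cycle winds around the point, hence meets this diagonal. *)

(** * Lozenges as adjacent pairs of an up and a down triangle *)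

(* The up triangle (u, true) and the down triangle (d, false) share an edge. *)
Definition adj (u d : point) : bool :=
  [|| (u.1 == d.1) && (u.2 == d.2), (u.1 == d.1 + 1)%R && (u.2 == d.2)
    | (u.1 == d.1) && (u.2 == d.2 + 1)%R].

Lemma card_fsetI_seq (K : choiceType) (A B : {fset K}) (r : seq K) :
  uniq r -> A =i r -> #|` (A `&` B)%fset| = count [in B] r.
Proof.
move=> r_uniq Ar; rewrite -size_filter -(undup_id (filter_uniq [in B] r_uniq)).
rewrite -card_fseq; congr #|` _|; apply/fsetP=> x.
rewrite in_fsetI Ar inE. by rewrite mem_filter andbC.
Qed.

Lemma card_vertices_cap (s : triangle) (B : {fset point}) :
  #|` (vertices s `&` B)%fset| =
  ((if s.2 then s.1 else s.1 + e1 + e2)%R \in B) +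
  (((s.1 + e1)%R \in B) + ((s.1 + e2)%R \in B)).
Proof.
rewrite (@card_fsetI_seq _ _ _
  [:: (if s.2 then s.1 else s.1 + e1 + e2)%R; (s.1 + e1)%R; (s.1 + e2)%R]).
- by rewrite /= addn0.
- case: s => [[x y] []] /=; rewrite !inE !xpair_eqE /=; lia.
- by move=> x; rewrite !inE orbA.
Qed.

Lemma mem_vertices (x y : int) (o : bool) (v : point) :
  (v \in vertices ((x, y), o)) =
  [|| if o then (v.1 == x) && (v.2 == y) else (v.1 == x + 1)%R && (v.2 == y + 1)%R,
      (v.1 == x + 1)%R && (v.2 == y) | (v.1 == x) && (v.2 == y + 1)%R].
Proof.
case: v => vx vy; rewrite /vertices !inE /=; case: o; rewrite !xpair_eqE /=; lia.
Qed.

(** Two triangles of the same orientation share all three vertices or at most one, so sharing an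
    edge forces opposite orientations. *)
Lemma share_edgeP (s t : triangle) :
  share_edge s t <-> s.2 != t.2 /\ (if s.2 then adj s.1 t.1 else adj t.1 s.1).
Proof.
rewrite /share_edge card_vertices_cap.
case: s => [[x y] o]; case: t => [[x' y'] o']; rewrite !mem_vertices /adj /=.
by case: o; case: o' => /=; split; lia.
Qed.

Definition lz (u d : point) : {fset triangle} := [fset (u, true); (d, false)]%fset.

Lemma mem_lz (u d v : point) (o : bool) :
  ((v, o) \in lz u d) = (v == if o then u else d).
Proof. by rewrite !inE /= !xpair_eqE; case: o; rewrite ?andbT ?andbF ?orbF. Qed.

Lemma lz_inj (u d u' d' : point) : lz u d = lz u' d' -> u = u' /\ d = d'.
Proof.
move=> e; split; apply/eqP.
- by rewrite -[_ == _](mem_lz u' d' u true) -e mem_lz.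
- by rewrite -[_ == _](mem_lz u' d' d false) -e mem_lz.
Qed.

Lemma lozengeP (L : {fset triangle}) :
  lozenge L <-> exists u d, adj u d /\ L = lz u d.
Proof.
split=> [[[s []] [[t []] [/share_edgeP [//= _ st ->]]]]|[u [d [ud ->]]]].
- by exists s, t.
- by exists t, s; rewrite /lz fsetUC.
- by exists (u, true), (d, false); split=> //; apply/share_edgeP.
Qed.

(** * Tilings as perfect matchings *)

Section Tiling.

Variables (R : region) (T : {fset {fset triangle}}).
Hypothesis RT : lozenge_tiling R T.

Lemma tiling_lz (L : {fset triangle}) : L \in T ->
  exists u d, [/\ adj u d, (u, true) \in R, (d, false) \in R & L = lz u d].
Proof.
case: RT => T_loz T_sub _ LT.
have [u [d [ud Ld]]] := (lozengeP L).1 (T_loz L LT).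
have /fsubsetP sub := T_sub L LT.
by exists u, d; split=> //; apply: sub; rewrite Ld mem_lz.
Qed.

Lemma tiling_sub_lz (u d : point) : lz u d \in T ->
  [/\ adj u d, (u, true) \in R & (d, false) \in R].
Proof. by case/tiling_lz=> u' [d' [? ? ? /lz_inj[-> ->]]]. Qed.

Lemma tiling_up (u : point) : (u, true) \in R -> exists d, lz u d \in T.
Proof.
case: RT => _ _ T_cover /T_cover [L [[LT uL] _]].
have [u' [d [_ _ _ Ld]]] := tiling_lz LT.
by exists d; move: uL; rewrite Ld mem_lz => /eqP ->; rewrite -Ld.
Qed.

Lemma tiling_dn (d : point) : (d, false) \in R -> exists u, lz u d \in T.
Proof.
case: RT => _ _ T_cover /T_cover [L [[LT dL] _]].
have [u [d' [_ _ _ Ld]]] := tiling_lz LT.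
by exists u; move: dL; rewrite Ld mem_lz => /eqP ->; rewrite -Ld.
Qed.

Lemma tiling_meet (t : triangle) (L L' : {fset triangle}) :
  L \in T -> L' \in T -> t \in L -> t \in L' -> L = L'.
Proof.
case: RT => _ T_sub T_cover LT L'T tL tL'.
have tR : t \in R by apply: (fsubsetP (T_sub L LT)).
have [L0 [_ L0_uniq]] := T_cover t tR.
by rewrite -(L0_uniq L (conj LT tL)) -(L0_uniq L' (conj L'T tL')).
Qed.

Lemma tiling_inj_up (u u' d : point) : lz u d \in T -> lz u' d \in T -> u = u'.
Proof.
move=> ud u'd.
have /lz_inj[] // : lz u d = lz u' d.
by apply: (tiling_meet (t := (d, false))); rewrite ?mem_lz.
Qed.

Lemma tiling_inj_dn (u d d' : point) : lz u d \in T -> lz u d' \in T -> d = d'.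
Proof.
move=> ud ud'.
have /lz_inj[] // : lz u d = lz u d'.
by apply: (tiling_meet (t := (u, true))); rewrite ?mem_lz.
Qed.

End Tiling.

Definition matching_tiling (R : region) (m : point -> point) :
    {fset {fset triangle}} :=
  ((fun t : triangle => lz (m t.1) t.1) @` [fset t in R | ~~ t.2])%fset.

Lemma mem_matching_tiling (R : region) (m : point -> point) (u d : point) :
  (lz u d \in matching_tiling R m) = ((d, false) \in R) && (u == m d).
Proof.
apply/imfsetP/andP => /= [[[d' []]]|[dR /eqP ->]].
- by rewrite !inE andbF.
- by rewrite !inE andbT /= => d'R /lz_inj[-> ->].
- by exists (d, false) => //; rewrite !inE dR.
Qed.

Lemma matching_tilingP (R : region) (m : point -> point) :
    (forall d, (d, false) \in R -> adj (m d) d /\ (m d, true) \in R) ->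
    (forall d d', (d, false) \in R -> (d', false) \in R -> m d = m d' -> d = d') ->
    (forall u, (u, true) \in R -> exists2 d, (d, false) \in R & m d = u) ->
  lozenge_tiling R (matching_tiling R m).
Proof.
move=> m_adj m_inj m_surj.
have memP L : L \in matching_tiling R m ->
    exists2 d, (d, false) \in R & L = lz (m d) d.
  case/imfsetP=> /= -[d []]; rewrite !inE ?andbF // andbT => dR ->.
  by exists d.
split=> [L /memP [d dR ->]|L /memP [d dR ->]|[v o] vR].
- by apply/lozengeP; exists (m d), d; have [] := m_adj d dR.
- have [_ mR] := m_adj d dR.
  by apply/fsubsetP=> -[w []]; rewrite mem_lz => /eqP ->.
have [d dR vd] : exists2 d, (d, false) \in R & v = if o then m d else d.
  by case: o vR => vR; [have [d ? <-] := m_surj v vR; exists d | exists v].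
exists (lz (m d) d); split=> [|L [/memP [d' d'R ->]]].
  by rewrite mem_matching_tiling dR eqxx mem_lz vd.
rewrite mem_lz vd => /eqP; case: o {vR vd} => [/(m_inj _ _ dR d'R)|] -> //.
Qed.

Lemma tiling_matching (R : region) (T : {fset {fset triangle}}) :
  lozenge_tiling R T ->
  exists m : point -> point, forall d, (d, false) \in R -> lz (m d) d \in T.
Proof.
(* Matching on [idP] yields the membership proof that [tiling_dn] needs; [d] is a junk value outside
   [R]. *)
move=> RT; exists (fun d =>
  if @idP ((d, false) \in R) is ReflectT dR then xchoose (tiling_dn RT dR) else d).
by move=> d; case: {-}_ / idP => // dR _; apply: xchooseP (tiling_dn RT dR).
Qed.

(** * The lower bound from alternating cycles *)

Definition up_of (L : {fset triangle}) : point :=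
  (head ((0, 0)%R, true) [seq t : triangle <- L | t.2]).1.

Lemma up_of_lz (u d : point) : up_of (lz u d) = u.
Proof.
rewrite /up_of; set s := [seq t <- _ | _].
have : (u, true) \in s by rewrite mem_filter /= mem_lz.
have : all (pred1 (u, true)) s.
  by apply/allP => -[v []]; rewrite mem_filter //= mem_lz => /eqP ->.
by case: s => //= t s /andP[/eqP -> _].
Qed.

(** What the lower bound retains of an n-dimensional kernel: [S] plays the support of a nonzero
    kernel element vanishing on [U], and no down triangle has exactly one neighbour in [S]. *)
Definition avoiding_support (R : region) (n : nat) : Prop :=
  forall U : seq point, size U < n -> exists S : {fset point},
  [/\ S != fset0, {in S, forall u, (u, true) \in R},
      {in S, forall u, u \notin U}
    & forall u d, u \in S -> (d, false) \in R -> adj u d ->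
        exists u', [/\ u' \in S, u' != u & adj u' d]].

(* A minimal nonempty set closed under the walk in the support is a union of
   alternating cycles. *)
Lemma forcing_lower_bound (R : region) (T F : {fset {fset triangle}}) (n : nat) :
    lozenge_tiling R T -> avoiding_support R n -> forcing_set R T F ->
  n <= #|` F|.
Proof.
move=> RT R_avoid [F_sub F_forces]; rewrite leqNgt; apply/negP => F_small.
have [|S [S_n0 S_R S_F S_adj]] := R_avoid [seq up_of L | L <- F].
  by rewrite size_map.
(* One step of the walk: across the lozenge of [T] at [x], then to another up triangle of [S] next
   to its down triangle. *)
pose next (x y : S) := val y != val x /\
  exists2 d, lz (val x) d \in T & adj (val y) d.
have [g g_next] : exists g : S -> S, forall x, next x (g x).
  apply: fin_all_exists => x.
  have [d xd] := tiling_up RT (S_R _ (valP x)).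
  have [x_d _ dR] := tiling_sub_lz RT xd.
  have [y [yS yx y_d]] := S_adj _ d (valP x) dR x_d.
  by exists [` yS]%fset; split=> //; exists d.
pose closed (C : {set S}) := (C != set0) && (g @: C \subset C).
have [|C /minsetP[/andP[C_n0 gC] C_min] _] := @minset_exists _ closed setT.
  apply/andP; split; last exact: subsetT.
  by rewrite -card_gt0 cardsT -cardfE cardfs_gt0.
(* The image of [C] is again closed, so by minimality [g] permutes [C]. *)
have gCE : g @: C = C.
  apply: (C_min _ _ gC); apply/andP; split; last exact: imsetS.
  by have /set0Pn[x xC] := C_n0; apply/set0Pn; exists (g x); apply: imset_f.
have g_inj : {in C &, injective g} by apply/imset_injP; rewrite gCE.
have [m mP] := tiling_matching RT.
(* Rotate [T] along the cycles of [g] in [C]: a partner [x] in [C] is replaced by [g x]. *)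
pose m' d := if [pick x in C | val x == m d] is Some x then val (g x) else m d.
have m'P d : (exists x, [/\ x \in C, val x = m d & m' d = val (g x)]) \/
    ((forall x, x \in C -> val x != m d) /\ m' d = m d).
  rewrite /m'; case: pickP => [x /andP[xC /eqP xd]|noC]; first by left; exists x.
  by right; split=> // x xC; have := noC x; rewrite xC /= => ->.
have m_inj d d' : (d, false) \in R -> (d', false) \in R -> m d = m d' -> d = d'.
  by move=> dR d'R e; apply: (tiling_inj_dn RT (mP d dR)); rewrite e mP.
have m_surj u : (u, true) \in R -> exists2 d, (d, false) \in R & m d = u.
  move=> /(tiling_up RT)[d ud]; have [_ _ dR] := tiling_sub_lz RT ud.
  by exists d => //; apply: (tiling_inj_up RT (mP d dR) ud).
have gP x : x \in C -> g x \in C by move=> xC; apply: (subsetP gC); apply: imset_f.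
have T'_tiling : lozenge_tiling R (matching_tiling R m').
  apply: matching_tilingP => [d dR|d d' dR d'R|u uR].
  - have [[x [xC xd ->]]|[_ ->]] := m'P d; last first.
      by have [? ? _] := tiling_sub_lz RT (mP d dR).
    split; last exact: S_R (valP _).
    have [_ [d' xd' gxd']] := g_next x.
    suff <- : d' = d by [].
    by apply: (tiling_inj_dn RT xd'); rewrite xd mP.
  - have [[x [xC xd ->]]|[d_C ->]] := m'P d;
      have [[y [yC yd ->]]|[d'_C ->]] := m'P d'.
    + by move=> /val_inj/(g_inj _ _ xC yC) xy; apply: m_inj => //; rewrite -xd xy.
    + by move=> e; case/eqP: (d'_C _ (gP x xC)).
    + by move=> e; case/eqP: (d_C _ (gP y yC)).
    + exact: m_inj.
  have [d dR du] := m_surj u uR.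
  have [[x [xC xd _]]|[d_C m'd]] := m'P d; last by exists d; rewrite ?m'd.
  have : x \in g @: C by rewrite gCE.
  case/imsetP=> y yC xy; have [d' d'R d'y] := m_surj _ (S_R _ (valP y)).
  exists d' => //; have [[z [zC zd' ->]]|[/(_ y yC)/eqP]] := m'P d'; last by rewrite d'y.
  by rewrite -du -xd xy; congr (val (g _)); apply: val_inj; rewrite zd' d'y.
(* The lozenges of [F] survive the rotation, since [S] avoids their up triangles. *)
have T'T : matching_tiling R m' = T.
  apply: F_forces T'_tiling _; apply/fsubsetP=> L LF.
  have LT : L \in T := fsubsetP F_sub L LF.
  have [u [d [_ uR dR Ld]]] := tiling_lz RT LT.
  rewrite Ld mem_matching_tiling dR /=; apply/eqP.
  have md : m d = u by apply: (tiling_inj_up RT (mP d dR)); rewrite -Ld.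
  have [[x [_ xd _]]|[_ ->]] := m'P d; last by [].
  have /negP[] := S_F _ (valP x); apply/mapP; exists L => //.
  by rewrite Ld up_of_lz xd.
(* But [g] moves every element of [C], so the two tilings differ. *)
have /set0Pn[x xC] := C_n0; have [d dR dx] := m_surj _ (S_R _ (valP x)).
have [[y [yC yd m'd]]|[/(_ x xC)/eqP]] := m'P d; last by rewrite dx.
have : lz (m' d) d \in T by rewrite -T'T mem_matching_tiling dR eqxx.
move=> /(tiling_inj_up RT (mP d dR)); rewrite m'd -yd => e.
by have [/eqP[]] := g_next y.
Qed.

(** * Standard coordinates on the hexagon *)

(* The up and down triangles of the hexagon that has a corner at the origin,
   followed counterclockwise by sides a, b, c in directions e1, e2, e2 - e1. *)
Definition up_hex (a b c : nat) (u : point) : bool :=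
  [&& 0 <= u.2, u.2 < (b + c)%:Z, - c%:Z <= u.1, u.1 < a%:Z,
      0 <= u.1 + u.2 & u.1 + u.2 < (a + b)%:Z]%R.

Definition dn_hex (a b c : nat) (d : point) : bool :=
  [&& 0 <= d.2, d.2 < (b + c)%:Z, - c%:Z <= d.1, d.1 < a%:Z,
      -1 <= d.1 + d.2 & d.1 + d.2 < (a + b)%:Z - 1]%R.

(** Up and down triangles get separate bijections because a rotation acts differently on their base
    points. *)
Record hex_chart (a b c : nat) (R : region) (f f' g g' : point -> point) : Prop :=
  HexChart {
    hex_fK : cancel f f';
    hex_f'K : cancel f' f;
    hex_gK : cancel g g';
    hex_g'K : cancel g' g;
    hex_adj : forall u d, adj (f u) (g d) = adj u d;
    hex_up : forall u, ((f u, true) \in R) = up_hex a b c u;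
    hex_dn : forall d, ((g d, false) \in R) = dn_hex a b c d }.

(* In the third coordinate -x - y for up triangles and -1 - x - y for down
   triangles, adjacency means that two coordinates agree, so it is invariant
   under cyclic shifts of the three coordinates. *)
Lemma hex_chart_rot (a b c : nat) (R : region) (f f' g g' : point -> point) :
    hex_chart a b c R f f' g g' ->
  exists h h' k k', hex_chart b c a R h h' k k'.
Proof.
case=> fK f'K gK g'K fg_adj fR gR.
(* With w the third coordinate, [r] and [s] both send (x, y, w) to (w + b - 1, x + c, y - b - c +
   1). *)
pose r (u : point) : point := (b%:Z - 1 - u.1 - u.2, u.1 + c%:Z)%R.
pose r' (u : point) : point := (u.2 - c%:Z, b%:Z + c%:Z - 1 - u.1 - u.2)%R.
pose s (u : point) : point := (b%:Z - 2 - u.1 - u.2, u.1 + c%:Z)%R.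
pose s' (u : point) : point := (u.2 - c%:Z, b%:Z + c%:Z - 2 - u.1 - u.2)%R.
have rK : cancel r r' by case=> x y; congr (_, _); rewrite /=; lia.
have r'K : cancel r' r by case=> x y; congr (_, _); rewrite /=; lia.
have sK : cancel s s' by case=> x y; congr (_, _); rewrite /=; lia.
have s'K : cancel s' s by case=> x y; congr (_, _); rewrite /=; lia.
exists (f \o r'), (r \o f'), (g \o s'), (s \o g').
split; try by apply: can_comp.
- by move=> [x y] [x' y']; rewrite /= fg_adj /adj /=; lia.
- by move=> [x y]; rewrite /= fR /up_hex /=; lia.
- by move=> [x y]; rewrite /= gR /dn_hex /=; lia.
Qed.

(** * The kernel of the weighted adjacency matrix *)

(** Each condition is linear in the n coefficients of [p]; with fewer than n conditions, [M] has a
    nonzero left kernel. *)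
Lemma poly_vanishing (F : fieldType) (n : nat) (r : seq (nat * {poly F})) :
    size r < n ->
  exists p : {poly F}, [/\ p != 0%R, size p <= n
    & {in r, forall i, ((p * i.2)`_i.1 = 0)%R}].
Proof.
move=> r_n; pose x j := nth (0, 0%R) r j.
pose M := (\matrix_(i < n, j < size r) ('X^i * (x j).2)`_(x j).1)%R.
pose v := nz_row (kermx M).
have v_n0 : v != 0%R.
  rewrite nz_row_eq0 kermx_eq0 -row_leq_rank -ltnNge.
  exact: leq_ltn_trans (rank_leq_col M) r_n.
exists (rVpoly v); split.
- by rewrite -(inj_eq (can_inj rVpolyK)) linear0 in v_n0.
- exact: size_poly.
move=> i /(nthP (0, 0%R))[j j_r <-].
have pE : (rVpoly v = \sum_k v 0 k *: 'X^k)%R.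
  rewrite {1}(row_sum_delta v) linear_sum; apply: eq_bigr => k _.
  by rewrite linearZ /= rVpoly_delta.
have /sub_kermxP/rowP/(_ (Ordinal j_r)) := nz_row_sub (kermx M).
rewrite !mxE => vM0; rewrite pE mulr_suml coef_sum -[RHS]vM0.
by apply: eq_bigr => k _; rewrite -scalerAl coefZ !mxE.
Qed.

Lemma coef_mulXsubC (F : comNzRingType) (p : {poly F}) (s : F) (k : nat) :
  ((p * ('X - s%:P))`_k = (if k is j.+1 then p`_j else 0) - s * p`_k)%R.
Proof. by rewrite mulrBr coefB coefMX coefMC mulrC; case: k. Qed.

Section Kernel.

Variables (a b c : nat) (z : algC) (p : {poly algC}).
Hypothesis z_prim : ((b + c).-primitive_root z)%R.

Definition ker_row (y : nat) : {poly algC} :=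
  (p * \prod_(0 <= i < y) ('X - (z ^+ i)%:P))%R.

(** Column x of row y holds the coefficient of X^(x + y); the sign test makes coefficients of
    negative degree vanish despite the absolute value. *)
Definition ker_at (u : point) : algC :=
  (if (0 <= u.1 + u.2)%R then (ker_row `|u.2|)`_`|(u.1 + u.2)%R| else 0)%R.

Lemma ker_row0 : ker_row 0 = p.
Proof. by rewrite /ker_row big_nil mulr1. Qed.

Lemma ker_rowS (y : nat) : (ker_row y.+1 = ker_row y * ('X - (z ^+ y)%:P))%R.
Proof. by rewrite /ker_row big_nat_recr //= mulrA. Qed.

Lemma ker_at_rec (x y : int) : (0 <= y -> -1 <= x + y ->
  ker_at (x, y + 1) = ker_at (x, y) - z ^+ `|y| * ker_at (x + 1, y))%R.
Proof.
case: y => // y _ xy; rewrite /ker_at /= addn1 ker_rowS coef_mulXsubC.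
have -> : (y%:Z + 1 = y.+1%:Z)%R by lia.
have -> : (x + 1 + y%:Z = x + y.+1%:Z)%R by lia.
have -> : (0 <= x + y.+1%:Z)%R by lia.
case: ifP => [xy0|xy0]; last by have -> : `|(x + y.+1%:Z)%R|%N = 0 by lia.
by have -> : `|(x + y.+1%:Z)%R|%N = `|(x + y%:Z)%R|.+1 by lia.
Qed.

(** The recurrence is a three-term relation with nonzero weights around [d], so it cannot have
    exactly one nonzero term. *)
Lemma ker_at_neighbour (u d : point) :
    dn_hex a b c d -> adj u d -> ker_at u != 0%R ->
  exists u', [/\ ker_at u' != 0%R, u' != u & adj u' d].
Proof.
case: u d => [x y] [x' y'] d_hex ud u_n0.
have n0 : (z ^+ `|y'| != 0)%R.
  by rewrite expf_neq0 // (prim_root_eq0 z_prim) -lt0n (prim_order_gt0 z_prim).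
have rec : (ker_at (x', y' + 1) =
            ker_at (x', y') - z ^+ `|y'| * ker_at (x' + 1, y'))%R.
  by apply: ker_at_rec; move: d_hex; rewrite /dn_hex /=; lia.
case/or3P: ud => /andP[/eqP/= ex /eqP/= ey]; subst x y.
- have [h0|h0] := eqVneq (ker_at (x' + 1, y')%R) 0%R.
    exists (x', y' + 1)%R; rewrite rec h0 mulr0 subr0 xpair_eqE /adj /=.
    by split=> //; lia.
  by exists (x' + 1, y')%R; rewrite xpair_eqE /adj /=; split=> //; lia.
- have [h0|h0] := eqVneq (ker_at (x', y')) 0%R.
    exists (x', y' + 1)%R; rewrite rec h0 sub0r oppr_eq0 mulf_neq0 //.
    by rewrite xpair_eqE /adj /=; split=> //; lia.
  by exists (x', y')%R; rewrite xpair_eqE /adj /=; split=> //; lia.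
have [h0|h0] := eqVneq (ker_at (x', y')) 0%R; last first.
  by exists (x', y')%R; rewrite xpair_eqE /adj /=; split=> //; lia.
exists (x' + 1, y')%R; move: u_n0; rewrite rec h0 sub0r oppr_eq0 mulf_eq0.
by rewrite negb_or xpair_eqE /adj /= => /andP[_ h1]; split=> //; lia.
Qed.

Hypotheses (ab : a <= b) (ac : a <= c) (p_size : size p <= a).

Lemma size_ker_row (y : nat) : size (ker_row y) <= a + y.
Proof.
elim: y => [|y IHy]; first by rewrite ker_row0 addn0.
rewrite ker_rowS; apply: leq_trans (size_polyMleq _ _) _.
by rewrite size_XsubC addn2 /= addnS ltnS.
Qed.

Lemma ker_at_hex (u d : point) :
  dn_hex a b c d -> adj u d -> ker_at u != 0%R -> up_hex a b c u.
Proof.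
case: u d => [x y] [x' y'] d_hex ud; rewrite /ker_at /=.
case: ifP => [xy|_]; last by rewrite eqxx.
(* Just above the top row, b <= x + y < a + b <= b + c, so neither p nor p X^(b + c) has a term of
   degree x + y. *)
have [y_top|y_lt] := @eqP int y (b + c)%:Z%R.
  subst y; rewrite absz_nat /ker_row (factor_Xn_sub_1 z_prim) mulrBr mulr1 coefB.
  move: d_hex ud; rewrite /dn_hex /adj /= => d_hex ud.
  rewrite coefMXn ifT ?sub0r ?oppr_eq0; last by lia.
  by rewrite nth_default ?eqxx //; apply: leq_trans p_size _; lia.
have [big|small] := leqP (a + `|y|) `|(x + y)%R|.
  by rewrite nth_default ?eqxx //; apply: leq_trans big; apply: size_ker_row.
by move=> _; move: d_hex ud; rewrite /dn_hex /up_hex /adj /=; lia.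
Qed.

End Kernel.

Lemma hex_avoiding_support (a b c : nat) (R : region) (f f' g g' : point -> point) :
    0 < a -> a <= b -> a <= c -> hex_chart a b c R f f' g g' ->
  avoiding_support R a.
Proof.
move=> a_gt0 ab ac [fK f'K gK g'K fg_adj fR gR] U U_a.
have [z z_prim] := @C_prim_root_exists (b + c) ltac:(lia).
pose row y := (\prod_(0 <= i < y) ('X - (z ^+ i)%:P))%R.
have [|p [p_n0 p_size pU]] := @poly_vanishing algC a
    [seq (`|((f' u).1 + (f' u).2)%R|, row `|(f' u).2|) | u <- U].
  by rewrite size_map.
pose h := ker_at z p.
have h_hex := ker_at_hex z_prim ab ac p_size.
pose S := [fset t.1 | t in [fset t in R | t.2 && (h (f' t.1) != 0%R)]]%fset.
have SP u : (u \in S) = (h (f' u) != 0%R) && ((u, true) \in R).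
  apply/imfsetP/andP => [[[v []]]|[hu uR]].
  - by rewrite !inE => /andP[vR /= hv] ->.
  - by rewrite !inE /= andbF.
  - by exists (u, true) => //; rewrite !inE uR.
exists S; split.
(* The bottom row lists the coefficients of [p], so the leading one gives a point of [S]. *)
- have [k [k_a pk]] : exists k, k < a /\ (p`_k != 0)%R.
    exists (size p).-1; rewrite -lead_coefE lead_coef_eq0; split=> //.
    by move: p_n0; rewrite -size_poly_gt0; lia.
  apply/fset0Pn; exists (f (k%:Z, 0))%R.
  rewrite SP fK fR /h /ker_at /ker_row /= ?addr0 ?addn0 big_nil mulr1 pk /up_hex /=.
  by lia.
- by move=> u; rewrite SP => /andP[].
- move=> u; rewrite SP => /andP[/negP hu _]; apply/negP => uU; apply: hu.
  rewrite /h /ker_at; case: ifP => // _.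
  by have /= -> := pU _ (map_f _ uU).
move=> u d; rewrite SP => /andP[hu uR] dR ud.
have d_hex : dn_hex a b c (g' d) by rewrite -gR g'K.
have ud' : adj (f' u) (g' d) by rewrite -fg_adj f'K g'K.
have [v [hv vu vd]] := ker_at_neighbour z_prim d_hex ud' hu.
exists (f v); rewrite SP fK hv fR (h_hex _ _ d_hex vd hv) -(g'K d) fg_adj vd.
by split=> //; apply: contraNneq vu => <-; rewrite fK.
Qed.

(** * The upper bound from the three-rhombus tiling *)

(* The up triangle matched with d in the tiling by three rhombi meeting at
   (0, b). *)
Definition corner_match (b : nat) (d : point) : point :=
  (if (0 <= d.1) && (d.2 < b%:Z) then d
   else if (d.1 < 0) && (d.1 + d.2 + 1 < b%:Z) then (d.1, d.2 + 1)
   else (d.1 + 1, d.2))%R.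

(* Decreases along alternating walks that avoid the diagonal x + y = b - 1 of
   the a x b rhombus: such a walk visits in turn the part of this rhombus below
   the diagonal, the b x c rhombus, the c x a rhombus, and the part above. *)
Definition corner_rank (a b c : nat) (d : point) : int :=
  (if (0 <= d.1) && (d.2 < b%:Z) then
     d.1 + d.2 + (if b%:Z <= d.1 + d.2 then 0 else 16 * (a + b + c)%:Z)
   else if (d.1 < 0) && (d.1 + d.2 + 1 < b%:Z) then 10 * (a + b + c)%:Z - d.2
   else 5 * (a + b + c)%:Z - d.1)%R.

Lemma corner_matchP (b : nat) (d : point) : adj (corner_match b d) d.
Proof.
case: d => x y; rewrite /corner_match /adj /=.
by do 2?case: ifP => _ /=; lia.
Qed.

Lemma corner_match_inj (b : nat) : injective (corner_match b).
Proof.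
case=> x y [x' y']; rewrite /corner_match /=.
by do 4?case: ifP => ? //=; case=> ? ?; congr (_, _); lia.
Qed.

Lemma corner_match_hex (a b c : nat) (d : point) :
  dn_hex a b c d -> up_hex a b c (corner_match b d).
Proof.
case: d => x y; rewrite /corner_match /dn_hex /up_hex /=.
by do 2?case: ifP => ? /=; lia.
Qed.

Lemma corner_match_surj (a b c : nat) (u : point) :
  up_hex a b c u -> exists2 d, dn_hex a b c d & corner_match b d = u.
Proof.
case: u => x y; rewrite /up_hex /= => u_hex.
pose d : point := if ((x < 0) && (x + y < b%:Z))%R then (x, y - 1)%R
  else if (y < b%:Z)%R then (x, y) else (x - 1, y)%R.
exists d; rewrite /d.
  by do 2?case: ifP => ?; rewrite /dn_hex /=; lia.
do 2?case: ifP => ?; rewrite /corner_match /=;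
  do 2?case: ifP => ? //=; congr (_, _); lia.
Qed.

Lemma corner_rank_ge0 (a b c : nat) (d : point) :
  dn_hex a b c d -> (0 <= corner_rank a b c d)%R.
Proof.
case: d => x y; rewrite /corner_rank /dn_hex /=.
by do 3?case: ifP => ? /=; lia.
Qed.

(** A step lowers x + y in the a x b rhombus, raises y in the b x c rhombus and raises x in the c x
    a rhombus; the offsets 16, 10, 5 and 0 times a + b + c order the four parts. *)
Lemma corner_rank_lt (a b c : nat) (d e : point) :
    dn_hex a b c d -> dn_hex a b c e -> adj (corner_match b d) e -> e != d ->
    ~~ ((0 <= d.1) && (d.1 + d.2 == b%:Z - 1))%R ->
    ~~ ((0 <= e.1) && (e.1 + e.2 == b%:Z - 1))%R ->
  (corner_rank a b c e < corner_rank a b c d)%R.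
Proof.
case: d e => x y [x' y']; rewrite xpair_eqE /dn_hex /adj /corner_match /corner_rank /=.
by do 6?case: ifP => ? /=; lia.
Qed.

Lemma hex_forcing_number (a b c : nat) (R : region) (f f' g g' : point -> point) :
    0 < a -> a <= b -> a <= c -> hex_chart a b c R f f' g g' ->
  forcing_number R a.
Proof.
move=> a_gt0 ab ac chart; have [fK f'K gK g'K fg_adj fR gR] := chart.
have R_avoid := hex_avoiding_support a_gt0 ab ac chart.
pose m d := f (corner_match b (g' d)).
have mP d : (d, false) \in R -> adj (m d) d /\ (m d, true) \in R.
  move=> dR; rewrite -{2}(g'K d) fg_adj corner_matchP fR.
  by split=> //; apply: corner_match_hex; rewrite -gR g'K.
have m_inj : injective m.
  by apply: inj_comp (can_inj fK) _; apply: inj_comp (@corner_match_inj b) (can_inj g'K).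
pose T := matching_tiling R m.
have RT : lozenge_tiling R T.
  apply: matching_tilingP => // [d d' _ _ /m_inj //|u uR].
  have [|d d_hex du] := @corner_match_surj a b c (f' u); first by rewrite -fR f'K.
  by exists (g d); rewrite ?gR // /m gK du f'K.
pose ray i : point := (i%:Z, b%:Z - 1 - i%:Z)%R.
pose F := [fset L in [seq lz (m (g (ray i))) (g (ray i)) | i <- iota 0 a]]%fset.
have F_card : #|` F|%fset <= a.
  by rewrite card_fseq (leq_trans (size_undup _)) // size_map size_iota.
have FP d : dn_hex a b c d -> ((0 <= d.1) && (d.1 + d.2 == b%:Z - 1))%R ->
    lz (m (g d)) (g d) \in F.
  case: d => x y; rewrite /dn_hex /= => d_hex d_ray.
  rewrite !inE; apply/mapP; exists `|x|; first by rewrite mem_iota; lia.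
  by have -> : ray `|x| = (x, y) by congr (_, _); lia.
have F_forces : forcing_set R T F.
  split.
    apply/fsubsetP=> L; rewrite !inE => /mapP[i]; rewrite mem_iota => i_a ->.
    by rewrite mem_matching_tiling gR eqxx andbT /dn_hex /=; lia.
  move=> T' RT' FT'.
  (* Induction on the rank: if [T'] matched the partner of [d] with some other [e], then [e] would
     be on the diagonal or of smaller rank, hence already matched as in [T], contradicting
     injectivity. *)
  have T'P n d : dn_hex a b c d -> (corner_rank a b c d < n%:Z)%R ->
      lz (m (g d)) (g d) \in T'.
    elim: n d => [|n IHn] d d_hex d_n.
      by have := corner_rank_ge0 d_hex; lia.
    have [d_ray|d_ray] := boolP ((0 <= d.1) && (d.1 + d.2 == b%:Z - 1))%R.
      exact: (fsubsetP FT' _ (FP d d_hex d_ray)).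
    have dR : (g d, false) \in R by rewrite gR.
    have [_ /(tiling_up RT')[e' de']] := mP _ dR.
    have [de'_adj _ e'R] := tiling_sub_lz RT' de'.
    pose e := g' e'; have e'E : e' = g e by rewrite g'K.
    have e_hex : dn_hex a b c e by rewrite -gR -e'E.
    have [ed|ed] := eqVneq e d; first by rewrite -{2}ed -e'E.
    have eT' : lz (m (g e)) (g e) \in T'.
      have [e_ray|e_ray] := boolP ((0 <= e.1) && (e.1 + e.2 == b%:Z - 1))%R.
        exact: (fsubsetP FT' _ (FP e e_hex e_ray)).
      apply: IHn => //.
      suff : (corner_rank a b c e < corner_rank a b c d)%R by lia.
      apply: corner_rank_lt => //.
      by rewrite -[d]gK -fg_adj -e'E.
    have := tiling_inj_up RT' eT'; rewrite -e'E => /(_ _ de') /m_inj.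
    by rewrite e'E => /(can_inj gK) /eqP; rewrite (negPf ed).
  apply/fsetP=> L; apply/idP/idP.
    move=> LT'; have [u [d [_ uR dR Ld]]] := tiling_lz RT' LT'.
    rewrite Ld mem_matching_tiling dR /=; apply/eqP.
    have d_hex : dn_hex a b c (g' d) by rewrite -gR g'K.
    have := T'P `|corner_rank a b c (g' d)|.+1 _ d_hex; rewrite g'K => md.
    apply: (tiling_inj_up RT' (d := d)); first by rewrite -Ld.
    by apply: md; lia.
  move=> LT; have [u [d [_ uR dR Ld]]] := tiling_lz RT LT.
  have d_hex : dn_hex a b c (g' d) by rewrite -gR g'K.
  move: LT; rewrite Ld mem_matching_tiling dR => /eqP ->.
  have := T'P `|corner_rank a b c (g' d)|.+1 _ d_hex; rewrite g'K; apply; lia.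
split.
  exists T; split=> //; split; last first.
    by move=> k [F' [F'_forces <-]]; apply: forcing_lower_bound F'_forces.
  exists F; split=> //; apply/eqP; rewrite eqn_leq F_card.
  exact: forcing_lower_bound F_forces.
move=> k [T' [RT' [[F' [F'_forces <-]] _]]].
exact: forcing_lower_bound F'_forces.
Qed.

(** * Reduction of an arbitrary hexagon to standard coordinates *)

Lemma dir_cases (d : nat) :
  dir d \in [:: (1, 0); (0, 1); (-1, 1); (-1, 0); (0, -1); (1, -1)]%R.
Proof.
elim: d => [|d]; first by [].
by rewrite /dir iterS; set v := iter _ _ _; rewrite !inE => /or4P[|||/or3P[]] /eqP ->.
Qed.

Lemma point_mulrn (x y : int) (n : nat) :
  (((x, y) : point) *+ n = (x * n%:Z, y * n%:Z))%R.
Proof. by elim: n => [|n IHn]; rewrite ?mulr0 // mulrS IHn !intS !mulrDr !mulr1. Qed.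

(** Opposite sides have equal lengths, so starting the boundary at the corner where direction [e1]
    leaves only shifts the lengths cyclically. *)
Lemma in_hexagon_std (a b c : nat) (p : point) (d : nat) :
  exists a' b' c' (q : point),
    (a', b', c') \in [:: (a, b, c); (b, c, a); (c, a, b)] /\
    forall v, in_hexagon a b c p d v <->
      [&& 0 <= v.2 - q.2, v.2 - q.2 <= (b' + c')%:Z, - c'%:Z <= v.1 - q.1,
          v.1 - q.1 <= a'%:Z, 0 <= v.1 - q.1 + (v.2 - q.2)
        & v.1 - q.1 + (v.2 - q.2) <= (a' + b')%:Z]%R.
Proof.
case: p => px py.
have dirD k : dir (d + k) = iter k rot60 (dir d) by rewrite /dir addnC iterD.
have cornerE k : corner a b c (px, py) d k =
    ((px, py) + \sum_(j < k) iter j rot60 (dir d) *+ side_length a b c j)%R.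
  by rewrite /corner; congr (_ + _)%R; apply: eq_bigr => j _; rewrite dirD.
have hexE v : in_hexagon a b c (px, py) d v <-> all (fun k =>
    (0 <= det2 (iter k rot60 (dir d)) (v - corner a b c (px, py) d k))%R) (iota 0 6).
  split=> [v_hex|/allP v_hex k k6]; last by rewrite dirD v_hex ?mem_iota.
  by apply/allP=> k; rewrite mem_iota -dirD => /v_hex.
have := dir_cases d; rewrite !inE => /or4P[|||/or3P[]] /eqP dE;
  (* The new origin is the corner from which a side leaves in direction [e1]. *)
  [ exists a, b, c, (px, py)
  | exists c, a, b, (px - c%:Z, py)%R
  | exists b, c, a, (px - b%:Z, py - c%:Z)%R
  | exists a, b, c, (px - a%:Z + c%:Z, py - b%:Z - c%:Z)%R
  | exists c, a, b, (px + b%:Z, py - a%:Z - b%:Z)%R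
  | exists b, c, a, (px + a%:Z, py - a%:Z)%R ];
  (split; first by rewrite !inE eqxx ?orbT); move=> [x y];
  rewrite hexE /= !cornerE !big_ord_recr !big_ord0 dE /side_length /=;
  by rewrite /rot60 /= !point_mulrn /det2 /=; lia.
Qed.

Lemma is_hexagon_chart (a b c : nat) (R : region) :
  is_hexagon a b c R -> exists a' b' c' f f' g g',
    (a', b', c') \in [:: (a, b, c); (b, c, a); (c, a, b)] /\
    hex_chart a' b' c' R f f' g g'.
Proof.
case=> p [d RP]; have [a' [b' [c' [q [abc hexP]]]]] := in_hexagon_std a b c p d.
pose f u : point := (u + q)%R; pose f' u : point := (u - q)%R.
exists a', b', c', f, f', f, f'; split=> //.
have verticesP x y o : (f (x, y), o) \in R <-> forall v : point,
    v \in vertices ((x + q.1)%R, (y + q.2)%R, o) -> in_hexagon a b c p d v.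
  exact: RP.
split; try by [exact: addrK | exact: subrK].
- by move=> [x y] [x' y']; rewrite /adj /=; lia.
- move=> [x y]; apply/idP/idP => [/verticesP R_v|u_hex].
    have := R_v (x + q.1, y + q.2)%R; have := R_v (x + q.1 + 1, y + q.2)%R.
    have := R_v (x + q.1, y + q.2 + 1)%R.
    by rewrite !mem_vertices !hexP /up_hex /= !eqxx /= ?orbT; lia.
  apply/verticesP=> -[vx vy]; rewrite mem_vertices hexP /=.
  by move: u_hex; rewrite /up_hex /=; lia.
move=> [x y]; apply/idP/idP => [/verticesP R_v|u_hex].
  have := R_v (x + q.1 + 1, y + q.2 + 1)%R; have := R_v (x + q.1 + 1, y + q.2)%R.
  have := R_v (x + q.1, y + q.2 + 1)%R.
  by rewrite !mem_vertices !hexP /dn_hex /= !eqxx /= ?orbT; lia.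
apply/verticesP=> -[vx vy]; rewrite mem_vertices hexP /=.
by move: u_hex; rewrite /dn_hex /=; lia.
Qed.

Theorem theorem4p5 (a b c : nat) (ha : 0 < a) (hb : 0 < b) (hc : 0 < c)
    (R : region) (hR : is_hexagon a b c R) :
  forcing_number R (minn a (minn b c)).
Proof.
have [a' [b' [c' [f [f' [g [g' [abc chart]]]]]]]] := is_hexagon_chart hR.
have [pos -> {a b c ha hb hc hR abc}] :
    [&& 0 < a', 0 < b' & 0 < c'] /\ minn a (minn b c) = minn a' (minn b' c').
  by move: abc; rewrite !inE => /or3P[] /eqP[-> -> ->]; lia.
have [/andP[ab ac]|not_a] := boolP ((a' <= b') && (a' <= c')).
  have -> : minn a' (minn b' c') = a' by lia.
  by apply: hex_forcing_number chart; lia.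
(* At most two rotations of the chart bring a shortest side to the front. *)
have [h [h' [k [k' chart1]]]] := hex_chart_rot chart.
have [/andP[bc ba]|not_b] := boolP ((b' <= c') && (b' <= a')).
  have -> : minn a' (minn b' c') = b' by lia.
  by apply: hex_forcing_number chart1; lia.
have [l [l' [i [i' chart2]]]] := hex_chart_rot chart1.
have -> : minn a' (minn b' c') = c' by lia.
by apply: hex_forcing_number chart2; lia.
Qed.
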